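(* Every BTP-truss is infinitesimally rigid, hence generic. The number of compatibility conditions of a truss obtained by a BTP combination is determined by those of its parts as follows, where $c_i$ denotes the number of compatibility conditions of the $i$-th part: (1) a single segment has $c=0$; (2) a bigon has $c_{\mathrm{bigon}}=c_1+c_2+1$; (3) a triangle has $c_{\mathrm{triangle}}=c_1+c_2+c_3$; (4) a prism has $c_{\mathrm{prism}}=c_1+\cdots+c_5$; (5) pinning a vertex gives $c_{\mathrm{pin}}=c_1+2$.
   Context: A truss is a finite graph (multiple edges allowed) with a position in the plane assigned to each vertex; distinct vertices may have the same position, but the two ends of an edge have distinct positions. With $v$ vertices and $e$ edges, the prescribed elongations problem is the linear system $AU=\lambda$, $\lambda\in\mathbf R^e$: $(V_i-V_j)\cdot(U_i-U_j)=\lambda_{ij}$ for every edge, with unknown displacements $U_i\in\mathbf R^2$. The number of compatibility conditions $c$ is the codimension of the range of $A$. The truss is infinitesimally rigid if $\ker A$ is three dimensional (consists exactly of velocity fields of rigid motions), and generic if $c=e-2v+3$. BTP-trusses (Bigon–Triangle–Prism) are the trusses obtained by finitely many applications of the following rules ($\amalg$ is disjoint union; ''$=$'' between $z$'s means equal coordinates, ''$\sim$'' means the vertices are identified; all edges are kept): 1. Single link: two vertices at different positions and the edge joining them. 2. Bigon: $S,T$ are BTP-trusses with vertices $z_1\neq z_2$ in $S$ and $z_3\ne z_4$ in $T$ (distinct positions), with $z_1=z_3$, $z_2=z_4$. The bigon is $(S\amalg T)/\{z_1\sim z_3,\ z_2\sim z_4\}$. 3. Triangle: $S,T,U$ are BTP-trusses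 with vertices $z_1\ne z_2$ in $S$, $z_3\neq z_4$ in $T$, $z_5\ne z_6$ in $U$, with $z_2=z_3$, $z_4=z_5$, $z_6=z_1$ and $z_1,z_2,z_4$ not collinear. The triangle is $(S\amalg T\amalg U)/\{z_2\sim z_3,\ z_4\sim z_5,\ z_6\sim z_1\}$. 4. Prism: $P,Q,R,S,T$ are BTP-trusses, with three distinct vertices $z_1,z_2,z_3$ in $P$, three distinct vertices $z_4,z_5,z_6$ in $Q$, and two vertices at distinct positions $z_7\ne z_{10}$ in $R$, $z_8\neq z_{11}$ in $S$, $z_9\ne z_{12}$ in $T$, with $z_k=z_{k+6}$ for $k=1,\dots,6$. Writing $z_k=(x_k,y_k)$, the nondegeneracy condition $$\left|\begin{matrix} x_1-x_4 & y_1-y_4 & x_1y_4-x_4y_1 \\ x_2-x_5 & y_2-y_5 & x_2y_5-x_5y_2 \\ x_3-x_6 & y_3-y_6 & x_3y_6-x_6y_3 \end{matrix}\right|\neq0$$ is required. The prism is $(P\amalg Q\amalg R\amalg S\amalg T)/\{z_k\sim z_{k+6}:k=1,\dots,6\}$. 5. Pinning: $T$ is a BTP-truss with two distinct vertices $z_1,z_2$ having the same coordinates. The result is $T/\{z_1\sim z_2\}$. *)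

(* Defs.v *)
From HB Require Import structures.
From mathcomp Require Import all_boot all_order all_algebra ring.
Set Implicit Arguments.
Unset Strict Implicit.
Unset Printing Implicit Defensive.
Import Order.TTheory GRing.Theory Num.Theory.
Local Open Scope ring_scope.
Local Open Scope quotient_scope.

(* A multigraph whose edges are stored with an arbitrary orientation; this
   orientation is irrelevant to all that follows. *)
Record truss (K : realFieldType) := Truss {
  vert : finType;
  edge : finType;
  pos : vert -> 'rV[K]_2;
  src : edge -> vert;
  tgt : edge -> vert;
  ends_distinct : forall a, pos (src a) != pos (tgt a)
}.

Arguments pos {K} t _ : rename.
Arguments src {K} t _ : rename.
Arguments tgt {K} t _ : rename.

Section Elongation.
Context {K : realFieldType}.
Implicit Types (T : truss K) (u v : 'rV[K]_2).

Definition xc u : K := u 0 ord0.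
Definition yc u : K := u 0 ord_max.

Definition dot u v : K := xc u * xc v + yc u * yc v.

Definition elongation_fun T (U : {ffun vert T -> 'rV[K]_2}) :
    {ffun edge T -> K^o} :=
  [ffun a => dot (pos T (src T a) - pos T (tgt T a))
                 (U (src T a) - U (tgt T a))].

Lemma elongation_fun_is_linear T : linear (@elongation_fun T).
Proof.
move=> k U W; apply/ffunP=> a; rewrite !ffunE /dot /xc /yc !mxE.
by rewrite /GRing.scale /=; ring.
Qed.

HB.instance Definition _ T :=
  GRing.isLinear.Build K {ffun vert T -> 'rV[K]_2} {ffun edge T -> K^o} *:%R
    (@elongation_fun T) (@elongation_fun_is_linear T).

Definition elongation T :
    'Hom({ffun vert T -> 'rV[K]_2}, {ffun edge T -> K^o}) :=
  linfun (@elongation_fun T).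

Lemma elongationE T U : elongation T U = elongation_fun U.
Proof. exact: lfunE. Qed.

Definition ncompat T : nat :=
  (\dim {: {ffun edge T -> K^o}} - \dim (limg (elongation T)))%N.

Definition rot90 u : 'rV[K]_2 := \row_j (if j == ord0 then - yc u else xc u).

(* Differentiating a one-parameter family of rigid motions of the plane at the
   identity gives a translation velocity b plus w times the rotation by pi/2. *)
Definition rigid_velocity T (U : {ffun vert T -> 'rV[K]_2}) : Prop :=
  exists (b : 'rV[K]_2) (w : K), forall z, U z = b + w *: rot90 (pos T z).

Definition infinitesimally_rigid T : Prop :=
  \dim (lker (elongation T)) = 3 /\
  (forall U, U \in lker (elongation T) <-> rigid_velocity U).

Definition generic T : Prop :=
  (ncompat T)%:Z = #|edge T|%:Z - 2 * #|vert T|%:Z + 3.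

(* Edges may be mapped with their ends exchanged. *)
Definition truss_iso S T : Prop :=
  exists (f : vert S -> vert T) (g : edge S -> edge T),
    [/\ bijective f, bijective g,
        forall z, pos T (f z) = pos S z
      & forall a, (src T (g a) = f (src S a) /\ tgt T (g a) = f (tgt S a)) \/
                  (src T (g a) = f (tgt S a) /\ tgt T (g a) = f (src S a))].

End Elongation.

Section DisjointUnion.
Variables (K : realFieldType) (S T : truss K).

Definition union_pos (z : vert S + vert T) : 'rV[K]_2 :=
  match z with inl x => pos S x | inr y => pos T y end.

Definition union_src (a : edge S + edge T) : vert S + vert T :=
  match a with inl e => inl (src S e) | inr e => inr (src T e) end.

Definition union_tgt (a : edge S + edge T) : vert S + vert T :=
  match a with inl e => inl (tgt S e) | inr e => inr (tgt T e) end.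

Lemma union_ends_distinct a : union_pos (union_src a) != union_pos (union_tgt a).
Proof. by case: a => e; apply: ends_distinct. Qed.

Definition disjoint_union : truss K :=
  @Truss K (vert S + vert T)%type (edge S + edge T)%type
    union_pos union_src union_tgt union_ends_distinct.

End DisjointUnion.

Notation "S ⨿ T" := (disjoint_union S T) (at level 40, left associativity).

Section Glue.
Variables (K : realFieldType) (T : truss K) (s : seq (vert T * vert T)).

Definition ident_rel : rel (vert T) :=
  [rel x y | ((x, y) \in s) || ((y, x) \in s)].

Lemma ident_sym : symmetric (connect ident_rel).
Proof.
by apply: sym_connect_sym => x y; exact: orbC.
Qed.

(* The equivalence relation generated by the pairs in s. *)
Definition ident_equiv : equiv_rel (vert T) :=
  EquivRel (connect ident_rel) (@connect0 _ _) ident_sym (@connect_trans _ _).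

Definition glue_quot := {eq_quot ident_equiv}.
(* quot_type carries the finType structure that {eq_quot _} lacks. *)
Definition glue_vert : finType := quot_type glue_quot.

Definition glue_class (x : vert T) : glue_vert := \pi_glue_quot x.

Lemma glue_classP x y :
  reflect (glue_class x = glue_class y) (connect ident_rel x y).
Proof. exact: eqmodP. Qed.

Hypothesis s_pos : {in s, forall p, pos T p.1 = pos T p.2}.

Definition glue_pos (z : glue_vert) : 'rV[K]_2 := pos T (repr (z : glue_quot)).

Lemma glue_posE x : glue_pos (glue_class x) = pos T x.
Proof.
rewrite /glue_pos; have /glue_classP/connectP[p] :
  glue_class (repr (glue_class x : glue_quot)) = glue_class x by exact: reprK.
elim: p (repr _) => [|y p IHp] z /=; first by move=> _ ->.
case/andP=> zy py eqx; rewrite -(IHp y py eqx).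
by case/orP: zy => /s_pos.
Qed.

Definition glue_src (a : edge T) : glue_vert := glue_class (src T a).
Definition glue_tgt (a : edge T) : glue_vert := glue_class (tgt T a).

Lemma glue_ends_distinct a : glue_pos (glue_src a) != glue_pos (glue_tgt a).
Proof. by rewrite !glue_posE ends_distinct. Qed.

Definition glue : truss K :=
  @Truss K glue_vert (edge T) glue_pos glue_src glue_tgt glue_ends_distinct.

End Glue.

Section Link.
Variables (K : realFieldType) (p q : 'rV[K]_2) (pq : p != q).

Definition link_pos (z : bool) := if z then q else p.

Lemma link_ends_distinct (a : unit) : link_pos false != link_pos true.
Proof. exact: pq. Qed.

Definition link : truss K :=
  @Truss K bool unit link_pos (fun=> false) (fun=> true) link_ends_distinct.

End Link.

Record bigon_data (K : realFieldType) (S T : truss K) := BigonData {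
  bigon_z1 : vert S;  bigon_z2 : vert S;
  bigon_z3 : vert T;  bigon_z4 : vert T;
  bigon_neq12 : pos S bigon_z1 != pos S bigon_z2;
  bigon_neq34 : pos T bigon_z3 != pos T bigon_z4;
  bigon_eq13 : pos S bigon_z1 = pos T bigon_z3;
  bigon_eq24 : pos S bigon_z2 = pos T bigon_z4
}.

Section Bigon.
Variables (K : realFieldType) (S T : truss K) (d : bigon_data S T).

Definition bigon_pairs : seq (vert (S ⨿ T) * vert (S ⨿ T)) :=
  [:: (inl (bigon_z1 d), inr (bigon_z3 d));
      (inl (bigon_z2 d), inr (bigon_z4 d))].

Lemma bigon_pairs_pos :
  {in bigon_pairs, forall p, pos (S ⨿ T) p.1 = pos (S ⨿ T) p.2}.
Proof.
move=> p; rewrite !inE; case/orP=> /eqP->.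
- exact: bigon_eq13.
- exact: bigon_eq24.
Qed.

Definition bigon : truss K := glue bigon_pairs_pos.

End Bigon.

Definition collinear (K : realFieldType) (p q r : 'rV[K]_2) : Prop :=
  exists (o v : 'rV[K]_2),
    v != 0 /\ forall z, z \in [:: p; q; r] -> exists t : K, z = o + t *: v.

Record triangle_data (K : realFieldType) (S T U : truss K) := TriangleData {
  tri_z1 : vert S;  tri_z2 : vert S;
  tri_z3 : vert T;  tri_z4 : vert T;
  tri_z5 : vert U;  tri_z6 : vert U;
  tri_neq12 : pos S tri_z1 != pos S tri_z2;
  tri_neq34 : pos T tri_z3 != pos T tri_z4;
  tri_neq56 : pos U tri_z5 != pos U tri_z6;
  tri_eq23 : pos S tri_z2 = pos T tri_z3;
  tri_eq45 : pos T tri_z4 = pos U tri_z5;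
  tri_eq61 : pos U tri_z6 = pos S tri_z1;
  tri_not_collinear :
    ~ collinear (pos S tri_z1) (pos S tri_z2) (pos T tri_z4)
}.

Section Triangle.
Variables (K : realFieldType) (S T U : truss K) (d : triangle_data S T U).

Definition triangle_pairs : seq (vert (S ⨿ T ⨿ U) * vert (S ⨿ T ⨿ U)) :=
  [:: (inl (inl (tri_z2 d)), inl (inr (tri_z3 d)));
      (inl (inr (tri_z4 d)), inr (tri_z5 d));
      (inr (tri_z6 d), inl (inl (tri_z1 d)))].

Lemma triangle_pairs_pos :
  {in triangle_pairs, forall p, pos (S ⨿ T ⨿ U) p.1 = pos (S ⨿ T ⨿ U) p.2}.
Proof.
move=> p; rewrite !inE; case/or3P=> /eqP->.
- exact: tri_eq23.
- exact: tri_eq45.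
- exact: tri_eq61.
Qed.

Definition triangle : truss K := glue triangle_pairs_pos.

End Triangle.

(* Triple (a, b, c) such that the line through z and w is {a y - b x = c};
   three such lines are linearly dependent exactly when they are concurrent or
   parallel (or one of them degenerates). *)
Definition line_coefs (K : realFieldType) (z w : 'rV[K]_2) : seq K :=
  [:: xc z - xc w; yc z - yc w; xc z * yc w - xc w * yc z].

Record prism_data (K : realFieldType) (P Q R S T : truss K) := PrismData {
  prism_z1 : vert P;  prism_z2 : vert P;  prism_z3 : vert P;
  prism_z4 : vert Q;  prism_z5 : vert Q;  prism_z6 : vert Q;
  prism_z7 : vert R;  prism_z10 : vert R;
  prism_z8 : vert S;  prism_z11 : vert S;
  prism_z9 : vert T;  prism_z12 : vert T;
  prism_uniq123 : uniq [:: prism_z1; prism_z2; prism_z3];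
  prism_uniq456 : uniq [:: prism_z4; prism_z5; prism_z6];
  prism_neq7_10 : pos R prism_z7 != pos R prism_z10;
  prism_neq8_11 : pos S prism_z8 != pos S prism_z11;
  prism_neq9_12 : pos T prism_z9 != pos T prism_z12;
  prism_eq1 : pos P prism_z1 = pos R prism_z7;
  prism_eq2 : pos P prism_z2 = pos S prism_z8;
  prism_eq3 : pos P prism_z3 = pos T prism_z9;
  prism_eq4 : pos Q prism_z4 = pos R prism_z10;
  prism_eq5 : pos Q prism_z5 = pos S prism_z11;
  prism_eq6 : pos Q prism_z6 = pos T prism_z12;
  prism_nondegenerate :
    \det (\matrix_(i < 3, j < 3)
            (nth [::] [:: line_coefs (pos P prism_z1) (pos Q prism_z4);
                          line_coefs (pos P prism_z2) (pos Q prism_z5);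
                          line_coefs (pos P prism_z3) (pos Q prism_z6)] i)`_j)
      != 0
}.

Section Prism.
Variables (K : realFieldType) (P Q R S T : truss K).
Variable d : prism_data P Q R S T.

Let X := P ⨿ Q ⨿ R ⨿ S ⨿ T.
Let inP (z : vert P) : vert X := inl (inl (inl (inl z))).
Let inQ (z : vert Q) : vert X := inl (inl (inl (inr z))).
Let inR (z : vert R) : vert X := inl (inl (inr z)).
Let inS (z : vert S) : vert X := inl (inr z).
Let inT (z : vert T) : vert X := inr z.

Definition prism_pairs : seq (vert X * vert X) :=
  [:: (inP (prism_z1 d), inR (prism_z7 d));
      (inP (prism_z2 d), inS (prism_z8 d));
      (inP (prism_z3 d), inT (prism_z9 d));
      (inQ (prism_z4 d), inR (prism_z10 d));
      (inQ (prism_z5 d), inS (prism_z11 d));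
      (inQ (prism_z6 d), inT (prism_z12 d))].

Lemma prism_pairs_pos : {in prism_pairs, forall p, pos X p.1 = pos X p.2}.
Proof.
move=> p; rewrite !inE.
case/orP=> [/eqP->|]; first exact: prism_eq1.
case/orP=> [/eqP->|]; first exact: prism_eq2.
case/orP=> [/eqP->|]; first exact: prism_eq3.
case/orP=> [/eqP->|]; first exact: prism_eq4.
by case/orP=> /eqP->; [exact: prism_eq5 | exact: prism_eq6].
Qed.

Definition prism : truss K := glue prism_pairs_pos.

End Prism.

Record pin_data (K : realFieldType) (T : truss K) := PinData {
  pin_z1 : vert T;  pin_z2 : vert T;
  pin_neq : pin_z1 != pin_z2;
  pin_eq : pos T pin_z1 = pos T pin_z2
}.

Section Pin.
Variables (K : realFieldType) (T : truss K) (d : pin_data T).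

Definition pin_pairs : seq (vert T * vert T) := [:: (pin_z1 d, pin_z2 d)].

Lemma pin_pairs_pos : {in pin_pairs, forall p, pos T p.1 = pos T p.2}.
Proof. by move=> p; rewrite !inE => /eqP->; exact: pin_eq. Qed.

Definition pinning : truss K := glue pin_pairs_pos.

End Pin.

(* [BTP_iso] expresses that trusses are considered up to relabelling of their
   vertices and edges; the other constructors build specific representatives. *)
Inductive BTP (K : realFieldType) : truss K -> Prop :=
| BTP_iso (S T : truss K) : truss_iso S T -> BTP S -> BTP T
| BTP_link (p q : 'rV[K]_2) (pq : p != q) : BTP (link pq)
| BTP_bigon (S T : truss K) (d : bigon_data S T) :
    BTP S -> BTP T -> BTP (bigon d)
| BTP_triangle (S T U : truss K) (d : triangle_data S T U) :
    BTP S -> BTP T -> BTP U -> BTP (triangle d)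
| BTP_prism (P Q R S T : truss K) (d : prism_data P Q R S T) :
    BTP P -> BTP Q -> BTP R -> BTP S -> BTP T -> BTP (prism d)
| BTP_pinning (T : truss K) (d : pin_data T) : BTP T -> BTP (pinning d).

(* Main.v *)
(* Two rigid velocity fields that agree at two distinct points are equal.  So a
   motion of a bigon, triangle or prism, which is a rigid velocity field on each
   part, is globally one as soon as the parts P and Q of a prism, or the three
   sides of a triangle, are forced to move together; this is what the
   nondegeneracy conditions give.  Hence every BTP-truss has a kernel of
   dimension 3, so that c = e - 2v + 3, and the formulas for c follow by counting
   vertices: gluing along k pairs of vertices, all 2k of them distinct, removes
   exactly k vertices. *)
Require Import Defs.
From HB Require Import structures.
From mathcomp Require Import all_boot all_order all_algebra.
From mathcomp Require Import ring zify.
Set Implicit Arguments.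
Unset Strict Implicit.
Unset Printing Implicit Defensive.
Import GRing.Theory Num.Theory.
Local Open Scope ring_scope.

(** * Rigid velocity fields in the plane *)

Section RigidVelocityFields.
Variable K : realFieldType.
Implicit Types (p q u v b : 'rV[K]_2) (w : K).

Definition rigid_field b w p : 'rV[K]_2 := b + w *: rot90 p.

Lemma plane_ext u v : xc u = xc v -> yc u = yc v -> u = v.
Proof.
move=> eqx eqy; apply/rowP=> j; case: (unliftP ord0 j) => [k|] ->; last exact: eqx.
by rewrite (_ : lift ord0 k = ord_max) //; apply/val_inj; rewrite /= ord1.
Qed.

Lemma xcD u v : xc (u + v) = xc u + xc v. Proof. exact: mxE. Qed.
Lemma ycD u v : yc (u + v) = yc u + yc v. Proof. exact: mxE. Qed.
Lemma xcN u : xc (- u) = - xc u. Proof. exact: mxE. Qed.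
Lemma ycN u : yc (- u) = - yc u. Proof. exact: mxE. Qed.
Lemma xcZ w u : xc (w *: u) = w * xc u. Proof. exact: mxE. Qed.
Lemma ycZ w u : yc (w *: u) = w * yc u. Proof. exact: mxE. Qed.
Lemma xc_rot90 u : xc (rot90 u) = - yc u. Proof. by rewrite [LHS]mxE. Qed.
Lemma yc_rot90 u : yc (rot90 u) = xc u. Proof. by rewrite [LHS]mxE. Qed.

Definition coordE := (xcD, ycD, xcN, ycN, xcZ, ycZ, xc_rot90, yc_rot90).

Lemma dot_rigid_field b w p q :
  dot (p - q) (rigid_field b w p - rigid_field b w q) = 0.
Proof. by rewrite /dot /rigid_field !coordE; ring. Qed.

Lemma dot_self_eq0 u : (dot u u == 0) = (u == 0).
Proof.
apply/idP/eqP=> [|->]; last by rewrite /dot /xc /yc !mxE mulr0 addr0.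
rewrite /dot -!expr2 paddr_eq0 ?sqr_ge0 // !sqrf_eq0 => /andP[/eqP x0 /eqP y0].
by apply: plane_ext; rewrite ?x0 ?y0 /xc /yc mxE.
Qed.

(** In dimension two the orthogonal complement of a nonzero vector is a line. The witness is the
    coefficient of the orthogonal projection of [v] onto [rot90 u], a vector as long as [u]. *)
Lemma dot_eq0_rot90 u v : u != 0 -> dot u v = 0 -> exists w, v = w *: rot90 u.
Proof.
rewrite -dot_self_eq0 => uu0 uv0; exists (dot (rot90 u) v / dot u u).
move: uv0 uu0; rewrite /dot !coordE => uv0 uu0; apply: plane_ext; rewrite !coordE.
  apply: (mulIf uu0); rewrite mulrAC divfK //.
  by rewrite -[LHS]subr0 -[in LHS](mulr0 (xc u)) -uv0; ring.
apply: (mulIf uu0); rewrite mulrAC divfK //.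
by rewrite -[LHS]subr0 -[in LHS](mulr0 (yc u)) -uv0; ring.
Qed.

Lemma rot90B u v : rot90 (u - v) = rot90 u - rot90 v.
Proof. by apply: plane_ext; rewrite !coordE; ring. Qed.

Lemma rot90_eq0 u : (rot90 u == 0) = (u == 0).
Proof. by rewrite -!dot_self_eq0 /dot !coordE mulrNN addrC. Qed.

Lemma rigid_fieldB b w b' w' p :
  rigid_field b w p - rigid_field b' w' p = rigid_field (b - b') (w - w') p.
Proof. by rewrite /rigid_field scalerBl opprD addrACA. Qed.

(** Subtracting the two values cancels the translation and leaves [w *: rot90 (p - q)]. *)
Lemma rigid_field_eq0 p q b w : p != q ->
  rigid_field b w p = 0 -> rigid_field b w q = 0 -> b = 0 /\ w = 0.
Proof.
move=> pq eqp eqq; have /eqP : w *: rot90 (p - q) = 0.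
  have <- : rigid_field b w p - rigid_field b w q = w *: rot90 (p - q).
    by rewrite /rigid_field; apply: plane_ext; rewrite !coordE; ring.
  by rewrite eqp eqq subrr.
rewrite scaler_eq0 rot90_eq0 subr_eq0 (negPf pq) orbF => /eqP w0.
by move: eqp; rewrite /rigid_field w0 scale0r addr0.
Qed.

Lemma rigid_field_inj p q b w b' w' : p != q ->
  rigid_field b w p = rigid_field b' w' p ->
  rigid_field b w q = rigid_field b' w' q -> b = b' /\ w = w'.
Proof.
move=> pq /eqP + /eqP; rewrite -subr_eq0 rigid_fieldB => /eqP eqp.
rewrite -subr_eq0 rigid_fieldB => /eqP eqq.
by have [/subr0_eq-> /subr0_eq->] := rigid_field_eq0 pq eqp eqq.
Qed.

(** Adding the three agreement equations around the triangle cancels the translations. What remains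
    is a linear relation between two side vectors, which are independent, with differences of
    angular velocities as coefficients. *)
Lemma triangle_rigid p1 p2 p3 b1 w1 b2 w2 b3 w3 : ~ collinear p1 p2 p3 ->
  p1 != p2 ->
  rigid_field b1 w1 p2 = rigid_field b2 w2 p2 ->
  rigid_field b2 w2 p3 = rigid_field b3 w3 p3 ->
  rigid_field b3 w3 p1 = rigid_field b1 w1 p1 ->
  [/\ b1 = b2, w1 = w2, b1 = b3 & w1 = w3].
Proof.
move=> noncol p12 eq12 eq23 eq31.
have rel : (w1 - w2) *: rot90 (p2 - p1) + (w2 - w3) *: rot90 (p3 - p1) = 0.
  transitivity (rigid_field b1 w1 p2 - rigid_field b2 w2 p2
     + (rigid_field b2 w2 p3 - rigid_field b3 w3 p3)
     + (rigid_field b3 w3 p1 - rigid_field b1 w1 p1)).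
    by apply: plane_ext; rewrite /rigid_field !coordE; ring.
  by rewrite eq12 eq23 eq31 !subrr !addr0.
have w23 : w2 = w3.
  apply/subr0_eq/eqP/negPn/negP => w0; apply: noncol.
  exists p1, (p2 - p1); split; first by rewrite subr_eq0 eq_sym.
  move=> z; rewrite !inE => /or3P[] /eqP ->.
  - by exists 0; rewrite scale0r addr0.
  - by exists 1; rewrite scale1r addrC subrK.
  (* This is [rel] solved for [p3 - p1], which puts [p3] on the line through [p1] and [p2]. *)
  exists (- (w1 - w2) / (w2 - w3)); apply/subr0_eq/eqP; rewrite -rot90_eq0.
  apply/eqP/(scalerI w0); rewrite scaler0 -[RHS]rel.
  by apply: plane_ext; rewrite !coordE; field.
have w12 : w1 = w2.
  move: rel => /eqP; rewrite w23 subrr scale0r addr0 scaler_eq0 rot90_eq0.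
  by rewrite [p2 - _ == _]subr_eq0 [p2 == _]eq_sym (negPf p12) orbF => /eqP/subr0_eq.
move: eq12 eq31; rewrite /rigid_field w12 w23 => /addIr-> /addIr->.
by split.
Qed.

(** Each bar imposes one linear equation on the relative velocity of the two bodies, which has three
    parameters; the coefficients of that equation are [line_coefs]. *)
Lemma prism_rigid p1 p2 p3 q1 q2 q3 b w b' w' :
  \det (\matrix_(i < 3, j < 3)
    (nth [::] [:: line_coefs p1 q1; line_coefs p2 q2; line_coefs p3 q3] i)`_j) != 0 ->
  dot (p1 - q1) (rigid_field b w p1 - rigid_field b' w' q1) = 0 ->
  dot (p2 - q2) (rigid_field b w p2 - rigid_field b' w' q2) = 0 ->
  dot (p3 - q3) (rigid_field b w p3 - rigid_field b' w' q3) = 0 ->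
  b = b' /\ w = w'.
Proof.
set M := \matrix_(_, _) _ => detM h1 h2 h3.
(* The sign of the last entry comes from [dot (p - q) (rot90 p)] and [dot (p - q) (rot90 q)], both
   equal to minus the third line coefficient. *)
pose c := [:: xc (b - b'); yc (b - b'); w' - w].
pose v : 'cV[K]_3 := \col_i c`_i.
have Mv0 : M *m v = 0.
  apply/colP=> i; rewrite !mxE !big_ord_recl big_ord0 addr0 !mxE /=.
  case: i => [[|[|[|//]]] ?] /=; [rewrite -h1 | rewrite -h2 | rewrite -h3];
    by rewrite /dot /rigid_field !coordE; ring.
have {}Mv0 : v = 0.
  by rewrite -[v](@mulKmx _ _ _ M) ?Mv0 ?mulmx0 // unitmxE unitfE.
have c0 i : (i < 3)%N -> c`_i = 0.
  by move=> ltin; have /colP/(_ (Ordinal ltin)) := Mv0; rewrite !mxE.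
split; last by apply/esym/subr0_eq/(c0 2).
apply/subr0_eq/plane_ext; first by rewrite [LHS](c0 0) // [RHS]mxE.
by rewrite [LHS](c0 1) // [RHS]mxE.
Qed.

End RigidVelocityFields.

(** * Motions of a truss and the kernel of its elongation map *)

Section Rigidity.
Variable K : realFieldType.
Implicit Types S T : truss K.

Definition motion T (U : vert T -> 'rV[K]_2) : Prop :=
  forall a, dot (pos T (src T a) - pos T (tgt T a))
                (U (src T a) - U (tgt T a)) = 0.

Definition moves_rigidly T (U : vert T -> 'rV[K]_2) : Prop :=
  exists b w, forall z, U z = rigid_field b w (pos T z).

(** The invariant for the induction on [BTP]. Plain functions compose directly with injections and
    quotient maps; an edge supplies two distinct positions, so that the kernel has full dimension
    3. *)
Definition rigid T : Prop :=
  (forall U : vert T -> 'rV[K]_2, motion U -> moves_rigidly U) /\ (0 < #|edge T|)%N.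

Lemma motionP T (U : {ffun vert T -> 'rV[K]_2}) :
  reflect (motion U) (U \in lker (elongation T)).
Proof.
rewrite memv_ker elongationE; apply: (iffP eqP) => [/ffunP U0 a | U0].
  by have := U0 a; rewrite !ffunE.
by apply/ffunP=> a; rewrite !ffunE U0.
Qed.

Definition rigid_field_fun T (bw : 'rV[K]_2 * K^o) : {ffun vert T -> 'rV[K]_2} :=
  [ffun z => rigid_field bw.1 bw.2 (pos T z)].

Lemma rigid_field_fun_is_linear T : linear (@rigid_field_fun T).
Proof.
move=> k bw bw'; apply/ffunP=> z; rewrite !ffunE /rigid_field /=.
by rewrite scalerDl scalerDr scalerA addrACA.
Qed.

HB.instance Definition _ T :=
  GRing.isLinear.Build K ('rV[K]_2 * K^o)%type {ffun vert T -> 'rV[K]_2} *:%R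
    (@rigid_field_fun T) (@rigid_field_fun_is_linear T).

Lemma rigid_kernel T U : rigid T ->
  U \in lker (elongation T) <-> rigid_velocity U.
Proof.
move=> [rigT _]; split=> [/motionP/rigT // | [b [w Ubw]]].
by apply/motionP=> a; rewrite !Ubw; apply: dot_rigid_field.
Qed.

(** The kernel is the image of the space of pairs [(b, w)], and this parametrization is injective
    because the ends of an edge have distinct positions. *)
Lemma rigid_dim_kernel T : rigid T -> \dim (lker (elongation T)) = 3.
Proof.
move=> rigT; have [a0 _] := card_gt0P (proj2 rigT).
have -> : lker (elongation T) = limg (linfun (@rigid_field_fun T)).
  apply/vspaceP=> U; apply/idP/memv_imgP.
    move=> /(rigid_kernel _ rigT)[b [w Ubw]]; exists (b, w); rewrite ?memvf //.
    by rewrite lfunE; apply/ffunP=> z; rewrite ffunE Ubw.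
  case=> bw _ ->; apply/(rigid_kernel _ rigT); exists bw.1, bw.2 => z.
  by rewrite lfunE ffunE.
rewrite limg_dim_eq ?dimvf; first by [].
apply/eqP; rewrite capfv; apply/lker0P=> [[b w] [b' w']]; rewrite !lfunE => /ffunP eqf.
have := eqf (tgt T a0); have := eqf (src T a0); rewrite !ffunE /= => eqs eqt.
by have [-> ->] := rigid_field_inj (ends_distinct a0) eqs eqt.
Qed.

Lemma rigid_infinitesimally_rigid T : rigid T -> infinitesimally_rigid T.
Proof. by move=> rigT; split=> [|U];
  [exact: rigid_dim_kernel | exact: rigid_kernel]. Qed.

Lemma rigid_ncompat T : rigid T ->
  (ncompat T + 2 * #|vert T| = #|edge T| + 3)%N.
Proof.
move=> rigT; have := limg_ker_dim (elongation T) fullv.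
rewrite capfv rigid_dim_kernel // dimvf.
have -> : dim {ffun vert T -> 'rV[K]_2} = (#|vert T| * 2)%N by [].
(* The rank is at most the number of edges, so the truncated subtraction in [ncompat] is exact. *)
have := dimvS (subvf (limg (elongation T))); rewrite /ncompat dimvf.
have -> : dim {ffun edge T -> K^o} = #|edge T| by exact: muln1.
lia.
Qed.

Lemma rigid_generic T : rigid T -> generic T.
Proof. by move/rigid_ncompat; rewrite /generic; lia. Qed.

Lemma rigid_iso S T : truss_iso S T -> rigid S -> rigid T.
Proof.
move=> [f [g [bij_f bij_g posf endg]]] [rigS S_gt0].
split; last by rewrite -(bij_eq_card bij_g).
move=> U mU; have [|b [w Ubw]] := rigS (U \o f).
  move=> a; have := mU (g a); case: (endg a) => [[-> ->]|[-> ->]]; rewrite !posf //=.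
  (* Exchanging the ends of an edge changes the sign of both factors of [dot]. *)
  by move=> <-; rewrite /dot !coordE; ring.
exists b, w => z; have [f' _ f'K] := bij_f.
by rewrite -[z]f'K posf -Ubw.
Qed.

Lemma rigid_link p q (pq : p != q) : rigid (@link K p q pq).
Proof.
split; last by rewrite card_unit.
move=> U /(_ tt) /= /dot_eq0_rot90; rewrite subr_eq0 => /(_ pq)[w Uw].
(* The translation is chosen to match [U] at [p]; the angular velocity [w] then accounts for the
   other end. *)
exists (U false - w *: rot90 p), w => -[]; rewrite /rigid_field ?subrK //=.
rewrite -[LHS](subrK (U false)) -opprB Uw rot90B scalerBr opprB.
by rewrite addrC addrCA addrC.
Qed.

Lemma motion_union S T (U : vert (S ⨿ T) -> 'rV[K]_2) :
  motion U -> motion (U \o inl) /\ motion (U \o inr).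
Proof. by move=> mU; split=> a; [apply: (mU (inl a)) | apply: (mU (inr a))]. Qed.

(** * Motions and vertex count of a glued truss *)

Section Glue.
Variables (T : truss K) (s : seq (vert T * vert T)).
Hypothesis s_pos : {in s, forall p, pos T p.1 = pos T p.2}.

Lemma glue_class_pair x y : (x, y) \in s -> glue_class s x = glue_class s y.
Proof. by move=> sxy; apply/glue_classP/connect1; rewrite /ident_rel /= sxy. Qed.

(** Edges and positions are unchanged by gluing, so a motion of the quotient pulls back along
    [glue_class] to a motion of [T] that agrees on each glued pair. *)
Lemma rigid_glue : (0 < #|edge T|)%N ->
  (forall U : vert T -> 'rV[K]_2, motion U ->
     (forall x y, (x, y) \in s -> U x = U y) -> moves_rigidly U) ->
  rigid (glue s_pos).
Proof.
move=> T_gt0 rigT; split=> // U mU.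
have [|x y /glue_class_pair /= -> //|b [w Ubw]] := rigT (U \o glue_class s).
  by move=> a; have := mU a; rewrite /= !glue_posE.
by exists b, w => z; rewrite -[z in U z](reprK (z : glue_quot s)) [LHS]Ubw.
Qed.

(** The pairs are disjoint, so each class has exactly one vertex outside [unzip2 s]; the map [f]
    below retracts onto these representatives. *)
Lemma card_glue : uniq (unzip1 s ++ unzip2 s) ->
  (#|vert (glue s_pos)| + size s = #|vert T|)%N.
Proof.
rewrite cat_uniq => /and3P[uniq1 disj12 uniq2].
pose f x := if x \in unzip2 s then nth x (unzip1 s) (index x (unzip2 s)) else x.
have notin2 x : x \in unzip1 s -> x \notin unzip2 s.
  by move=> x1; apply: contra disj12 => x2; apply/hasP; exists x.
have f_pair x y : (x, y) \in s -> f x = x /\ f y = x.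
  move=> sxy; have x1 : x \in unzip1 s by apply/mapP; exists (x, y).
  have y2 : y \in unzip2 s by apply/mapP; exists (x, y).
  split; first by rewrite /f (negPf (notin2 x x1)).
  rewrite /f y2; set i := index (x, y) s.
  have lti : (i < size s)%N by rewrite index_mem.
  have si : nth (x, y) s i = (x, y) by apply: nth_index.
  (* Uniqueness of [unzip2 s] ensures that no earlier pair has second component [y]. *)
  have -> : index y (unzip2 s) = i.
    rewrite -(index_uniq (s := unzip2 s) y (i := i)) ?size_map //.
    by rewrite (nth_map (x, y)) // si.
  by rewrite (nth_map (x, y)) // si.
have f_class x : glue_class s (f x) = glue_class s x.
  case: (boolP (x \in unzip2 s)) => [/mapP[[x1 x2] sx /= ->]|x2]; last first.
    by rewrite /f (negPf x2).
  by have [_ ->] := f_pair _ _ sx; apply/glue_class_pair.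
have f_notin2 x : f x \notin unzip2 s.
  case: (boolP (x \in unzip2 s)) => [/mapP[[x1 x2] sx /= ->]|x2]; last first.
    by rewrite /f (negPf x2).
  by have [_ ->] := f_pair _ _ sx; apply/notin2/mapP; exists (x1, x2).
(* [f] takes the same value at both ends of a pair, hence is constant along a chain of pairs. *)
have f_inj x y : glue_class s x = glue_class s y -> f x = f y.
  move=> /glue_classP/connectP[p]; elim: p x => [|z p IHp] x /=; first by move=> _ ->.
  by move=> /andP[/orP[]/f_pair[e1 e2] py] /(IHp _ py) <-; rewrite e1 e2.
have -> : #|vert (glue s_pos)| = #|[predC unzip2 s]|.
  rewrite -(card_in_imset (f := glue_class s)) => [|x y x2 y2 /f_inj]; last first.
    by rewrite /f (negPf x2) (negPf y2).
  apply/esym/eq_card=> z; rewrite [RHS]inE; apply/imsetP.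
  exists (f (repr (z : glue_quot s))); first exact: f_notin2.
  by rewrite f_class; apply/esym/reprK.
by rewrite -(cardC (mem (unzip2 s))) (card_uniqP uniq2) size_map addnC.
Qed.

End Glue.

(** * Rigidity of the BTP combinations *)

Lemma rigid_bigon S T (d : bigon_data S T) : rigid S -> rigid T -> rigid (bigon d).
Proof.
move=> [rigS S_gt0] [rigT _]; apply: rigid_glue.
  by rewrite card_sum addn_gt0 S_gt0.
move=> U /motion_union[/rigS[b [w US]] /rigT[b' [w' UT]]] glueU.
have [eqb eqw] : b = b' /\ w = w'.
  apply: (rigid_field_inj (bigon_neq12 d)).
    by rewrite -US (bigon_eq13 d) -UT; apply: glueU; rewrite !inE eqxx.
  by rewrite -US (bigon_eq24 d) -UT; apply: glueU; rewrite !inE eqxx ?orbT.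
by exists b, w => -[z|z]; [apply: US | rewrite eqb eqw; apply: UT].
Qed.

Lemma rigid_triangle S T U (d : triangle_data S T U) :
  rigid S -> rigid T -> rigid U -> rigid (triangle d).
Proof.
move=> [rigS S_gt0] [rigT _] [rigU _]; apply: rigid_glue.
  by rewrite !card_sum !addn_gt0 S_gt0.
move=> V /motion_union[/motion_union[/rigS[b1 [w1 VS]] /rigT[b2 [w2 VT]]]].
move=> /rigU[b3 [w3 VU]] glueV.
have [||| eqb2 eqw2 eqb3 eqw3] := @triangle_rigid K _ _ _ b1 w1 b2 w2 b3 w3
  (@tri_not_collinear _ _ _ _ d) (tri_neq12 d).
- by rewrite -VS (tri_eq23 d) -VT; apply: glueV; rewrite !inE eqxx.
- by rewrite -VT (tri_eq45 d) -VU; apply: glueV; rewrite !inE eqxx ?orbT.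
- by rewrite -VS -(tri_eq61 d) -VU; apply: glueV; rewrite !inE eqxx ?orbT.
rewrite -eqb2 -eqw2 in VT; rewrite -eqb3 -eqw3 in VU.
by exists b1, w1 => -[[z|z]|z]; [apply: VS | apply: VT | apply: VU].
Qed.

(** Each of [R], [S], [T] acts as a bar: its field agrees with that of [P] at one end and that of
    [Q] at the other, which gives the equations of [prism_rigid]. Once [P] and [Q] share a field,
    each bar agrees with it at two distinct points. *)
Lemma rigid_prism P Q R S T (d : prism_data P Q R S T) :
  rigid P -> rigid Q -> rigid R -> rigid S -> rigid T -> rigid (prism d).
Proof.
move=> [rigP P_gt0] [rigQ _] [rigR _] [rigS _] [rigT _]; apply: rigid_glue.
  by rewrite !card_sum !addn_gt0 P_gt0.
move=> U /motion_union[/motion_union[/motion_union[/motion_union[]]]].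
move=> /rigP[b [w UP]] /rigQ[b' [w' UQ]] /rigR[bR [wR UR]].
move=> /rigS[bS [wS US]] /rigT[bT [wT UT]] glueU.
have [e1 e4] :
    rigid_field b w (pos R (prism_z7 d)) = rigid_field bR wR (pos R (prism_z7 d)) /\
    rigid_field b' w' (pos R (prism_z10 d)) =
    rigid_field bR wR (pos R (prism_z10 d)).
  split; first by rewrite -(prism_eq1 d) -UP (prism_eq1 d) -UR;
    apply: glueU; rewrite !inE eqxx.
  by rewrite -(prism_eq4 d) -UQ (prism_eq4 d) -UR;
    apply: glueU; rewrite !inE eqxx ?orbT.
have [e2 e5] :
    rigid_field b w (pos S (prism_z8 d)) = rigid_field bS wS (pos S (prism_z8 d)) /\
    rigid_field b' w' (pos S (prism_z11 d)) =
    rigid_field bS wS (pos S (prism_z11 d)).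
  split; first by rewrite -(prism_eq2 d) -UP (prism_eq2 d) -US;
    apply: glueU; rewrite !inE eqxx ?orbT.
  by rewrite -(prism_eq5 d) -UQ (prism_eq5 d) -US;
    apply: glueU; rewrite !inE eqxx ?orbT.
have [e3 e6] :
    rigid_field b w (pos T (prism_z9 d)) = rigid_field bT wT (pos T (prism_z9 d)) /\
    rigid_field b' w' (pos T (prism_z12 d)) =
    rigid_field bT wT (pos T (prism_z12 d)).
  split; first by rewrite -(prism_eq3 d) -UP (prism_eq3 d) -UT;
    apply: glueU; rewrite !inE eqxx ?orbT.
  by rewrite -(prism_eq6 d) -UQ (prism_eq6 d) -UT;
    apply: glueU; rewrite !inE eqxx ?orbT.
have [||| eqb eqw] := prism_rigid (prism_nondegenerate d)
  (b := b) (w := w) (b' := b') (w' := w').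
- by rewrite (prism_eq1 d) (prism_eq4 d) e1 e4 dot_rigid_field.
- by rewrite (prism_eq2 d) (prism_eq5 d) e2 e5 dot_rigid_field.
- by rewrite (prism_eq3 d) (prism_eq6 d) e3 e6 dot_rigid_field.
rewrite -eqb -eqw in e4 e5 e6 UQ.
have [ebR ewR] := rigid_field_inj (prism_neq7_10 d) e1 e4.
have [ebS ewS] := rigid_field_inj (prism_neq8_11 d) e2 e5.
have [ebT ewT] := rigid_field_inj (prism_neq9_12 d) e3 e6.
rewrite -ebR -ewR in UR; rewrite -ebS -ewS in US; rewrite -ebT -ewT in UT.
exists b, w => -[[[[z|z]|z]|z]|z];
  [exact: UP | exact: UQ | exact: UR | exact: US | exact: UT].
Qed.

(** Pinning only adds constraints on the motions. *)
Lemma rigid_pinning T (d : pin_data T) : rigid T -> rigid (pinning d).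
Proof. by move=> [rigT T_gt0]; apply: rigid_glue => // U /rigT. Qed.

Lemma BTP_rigid T : BTP T -> rigid T.
Proof.
elim=> {T}.
- by move=> S T ST _; apply: rigid_iso ST.
- exact: rigid_link.
- by move=> S T d _ rS _ rT; apply: rigid_bigon.
- by move=> S T U d _ rS _ rT _ rU; apply: rigid_triangle.
- by move=> P Q R S T d _ rP _ rQ _ rR _ rS _ rT; apply: rigid_prism.
- by move=> T d _; apply: rigid_pinning.
Qed.

(** * Vertex counts of the combinations *)

Lemma inl_eq (A B : eqType) (x y : A) : (inl x == inl y :> A + B) = (x == y).
Proof. by []. Qed.

Lemma inr_eq (A B : eqType) (x y : B) : (inr x == inr y :> A + B) = (x == y).
Proof. by []. Qed.

Lemma inl_eq_inr (A B : eqType) (x : A) (y : B) : (inl x == inr y) = false.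
Proof. by []. Qed.

Lemma inr_eq_inl (A B : eqType) (x : A) (y : B) : (inr y == inl x) = false.
Proof. by []. Qed.

Definition sum_eqE := (inl_eq, inr_eq, inl_eq_inr, inr_eq_inl).

Lemma neq_of_pos T (x y : vert T) : pos T x != pos T y -> x != y.
Proof. by apply: contraNneq => ->. Qed.

Lemma card_bigon S T (d : bigon_data S T) :
  (#|vert (bigon d)| + 2 = #|vert S| + #|vert T|)%N.
Proof.
rewrite -card_sum; apply: card_glue; rewrite /= !inE /=.
rewrite !sum_eqE !orbF.
by rewrite (neq_of_pos (bigon_neq12 d)) (neq_of_pos (bigon_neq34 d)).
Qed.

Lemma card_triangle S T U (d : triangle_data S T U) :
  (#|vert (triangle d)| + 3 = #|vert S| + #|vert T| + #|vert U|)%N.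
Proof.
rewrite -!card_sum; apply: card_glue; rewrite /= !inE /=.
rewrite !sum_eqE !orbF.
(* The list of glued vertices meets the second vertex of each side before the first. *)
rewrite [tri_z2 d == _]eq_sym [tri_z4 d == _]eq_sym [tri_z6 d == _]eq_sym.
by rewrite (neq_of_pos (tri_neq12 d)) (neq_of_pos (tri_neq34 d))
  (neq_of_pos (tri_neq56 d)).
Qed.

Lemma card_prism P Q R S T (d : prism_data P Q R S T) :
  (#|vert (prism d)| + 6 =
     #|vert P| + #|vert Q| + #|vert R| + #|vert S| + #|vert T|)%N.
Proof.
rewrite -!card_sum; apply: card_glue; rewrite /= !inE /=.
rewrite !sum_eqE !orbF.
(* In [P] and [Q] the glued vertices are distinct but may share positions; in the bars distinctness
   comes from positions. *)
have := prism_uniq123 d; have := prism_uniq456 d; rewrite /= !inE !negb_or.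
move=> /and3P[/andP[-> ->] -> _] /and3P[/andP[-> ->] -> _].
by rewrite (neq_of_pos (prism_neq7_10 d)) (neq_of_pos (prism_neq8_11 d))
  (neq_of_pos (prism_neq9_12 d)).
Qed.

Lemma card_pinning T (d : pin_data T) : (#|vert (pinning d)| + 1 = #|vert T|)%N.
Proof. by apply: card_glue; rewrite /= !inE (pin_neq d). Qed.

End Rigidity.

Theorem theorem14 (K : realFieldType) :
  (forall T : truss K, BTP T -> infinitesimally_rigid T /\ generic T) /\
  (forall (p q : 'rV[K]_2) (pq : p != q), ncompat (link pq) = 0%N) /\
  (forall (S T : truss K) (d : bigon_data S T), BTP S -> BTP T ->
     ncompat (bigon d) = (ncompat S + ncompat T + 1)%N) /\
  (forall (S T U : truss K) (d : triangle_data S T U),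
     BTP S -> BTP T -> BTP U ->
     ncompat (triangle d) = (ncompat S + ncompat T + ncompat U)%N) /\
  (forall (P Q R S T : truss K) (d : prism_data P Q R S T),
     BTP P -> BTP Q -> BTP R -> BTP S -> BTP T ->
     ncompat (prism d) =
       (ncompat P + ncompat Q + ncompat R + ncompat S + ncompat T)%N) /\
  (forall (T : truss K) (d : pin_data T), BTP T ->
     ncompat (pinning d) = (ncompat T + 2)%N).
Proof.
split=> [T /BTP_rigid rT|].
  by split; [apply: rigid_infinitesimally_rigid | apply: rigid_generic].
split=> [p q pq|].
  by have := rigid_ncompat (rigid_link pq); rewrite card_unit card_bool; lia.
(* All edges are kept, so gluing [m] parts along [k] disjoint pairs adds [2 * k - 3 * (m - 1)] to
   the sum of the [ncompat]: 1 for a bigon, 0 for a triangle or a prism, 2 for a pinning. *)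
split=> [S T d /BTP_rigid rS /BTP_rigid rT|].
  have := rigid_ncompat (rigid_bigon d rS rT); have := card_bigon d.
  by rewrite card_sum; have := rigid_ncompat rS; have := rigid_ncompat rT; lia.
split=> [S T U d /BTP_rigid rS /BTP_rigid rT /BTP_rigid rU|].
  have := rigid_ncompat (rigid_triangle d rS rT rU); have := card_triangle d.
  rewrite !card_sum; have := rigid_ncompat rS; have := rigid_ncompat rT.
  by have := rigid_ncompat rU; lia.
split=> [P Q R S T d /BTP_rigid rP /BTP_rigid rQ /BTP_rigid rR
        /BTP_rigid rS /BTP_rigid rT|].
  have := rigid_ncompat (rigid_prism d rP rQ rR rS rT); have := card_prism d.
  rewrite !card_sum; have := rigid_ncompat rP; have := rigid_ncompat rQ.
  by have := rigid_ncompat rR; have := rigid_ncompat rS; have := rigid_ncompat rT; lia.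
move=> T d /BTP_rigid rT; have := rigid_ncompat (rigid_pinning d rT).
(* Gluing leaves the edge type unchanged, so this equality holds by computation. *)
rewrite [#|edge _|](_ : _ = #|edge T|) //.
by have := card_pinning d; have := rigid_ncompat rT; lia.
Qed.
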